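(* Let $H$ be a finite set of suppliers, where supplier $h\in H$ has $x_h\ge 0$ units of an $x$-input, $y_h\ge 0$ units of a $y$-input, and a shipping success probability $p_h\in[0,1]$. Let $\alpha,\beta>0$. For $S\subseteq H$ let $\Pi_1(S)$ be the expected output under the $S$-strategy (described in the context) with production function $f(x,y)=x^\alpha y^\beta$. Then $\Pi_1$ is an increasing function of $S$, i.e. $S\supseteq T$ implies $\Pi_1(S)\ge\Pi_1(T)$. In particular, the $H$-strategy maximizes the expected output over all $S$-strategies, $S\subseteq H$.
   Context: Under the $S$-strategy ($S\subseteq H$), each supplier $h\in S$ ships $x_h$ and $y_h$ together in one pooled shipment, and each supplier $h\in H\setminus S$ ships $x_h$ and $y_h$ in two separate shipments. Every shipment by supplier $h$ arrives with probability $p_h$, and arrivals are independent across suppliers and across different shipments of the same supplier. If $S_1$ (resp. $S_2$) denotes the random set of suppliers whose $x$-input (resp. $y$-input) arrives, the total inputs received are $x=\sum_{h\in S_1}x_h$ and $y=\sum_{h\in S_2}y_h$, and the output is $f(x,y)=x^\alpha y^\beta$. $\Pi_1(S)$ is the expectation of this output. *)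

(* Defs.v *)
From HB Require Import structures.
From mathcomp Require Import all_boot all_order all_algebra.
From mathcomp Require Import all_classical all_reals all_analysis.
Set Implicit Arguments.
Unset Strict Implicit.
Unset Printing Implicit Defensive.
Import Order.TTheory GRing.Theory Num.Theory.
Local Open Scope ring_scope.

Definition mutually_independent (R : realType) (d : measure_display)
    (Om : measurableType d) (P : probability Om R)
    (I : finType) (D : {set I}) (E : I -> set Om) : Prop :=
  forall A : {set I}, A \subset D ->
    P (\bigcap_(i in [set` A]) E i)%classic = (\prod_(i in A) P (E i))%E.

Inductive cargo := Pooled | OnlyX | OnlyY.

Definition option_of_cargo (k : cargo) : option bool :=
  match k with Pooled => None | OnlyX => Some true | OnlyY => Some false end.

Definition cargo_of_option (o : option bool) : cargo :=
  match o with None => Pooled | Some true => OnlyX | Some false => OnlyY end.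

Lemma option_of_cargoK : cancel option_of_cargo cargo_of_option.
Proof. by case. Qed.

HB.instance Definition _ := Equality.copy cargo (can_type option_of_cargoK).
HB.instance Definition _ := Choice.copy cargo (can_type option_of_cargoK).
HB.instance Definition _ := Countable.copy cargo (can_type option_of_cargoK).
HB.instance Definition _ := Finite.copy cargo (can_type option_of_cargoK).

Definition shipment (H : finType) : finType := (H * cargo)%type.

(* The shipments that are actually sent under the S-strategy. *)
Definition shipments (H : finType) (S : {set H}) : {set shipment H} :=
  finset (fun s : shipment H =>
    if s.2 == Pooled then s.1 \in S else s.1 \notin S).

(* The shipment that carries x_h (resp. y_h) under the S-strategy. *)
Definition x_shipment (H : finType) (S : {set H}) (h : H) : shipment H :=
  (h, if h \in S then Pooled else OnlyX).
Definition y_shipment (H : finType) (S : {set H}) (h : H) : shipment H :=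
  (h, if h \in S then Pooled else OnlyY).

(* [arrives s] is the event that the shipment s arrives; the two functions
   below are the random sets S_1 and S_2. *)
Definition x_arrived (H : finType) (Om : Type) (arrives : shipment H -> set Om)
    (S : {set H}) (w : Om) : {set H} :=
  finset (fun h : H => w \in arrives (x_shipment S h)).
Definition y_arrived (H : finType) (Om : Type) (arrives : shipment H -> set Om)
    (S : {set H}) (w : Om) : {set H} :=
  finset (fun h : H => w \in arrives (y_shipment S h)).

(* As [powR] satisfies [0 `^ a = 0] for [a != 0], this is the usual function
   on the closed quadrant when [alpha] and [beta] are positive. *)
Definition production (R : realType) (alpha beta : R) (x y : R) : R :=
  x `^ alpha * y `^ beta.

Definition output (R : realType) (H : finType) (Om : Type)
    (x y : H -> R) (alpha beta : R) (arrives : shipment H -> set Om)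
    (S : {set H}) (w : Om) : R :=
  production alpha beta
    (\sum_(h in x_arrived arrives S w) x h)
    (\sum_(h in y_arrived arrives S w) y h).

Definition Pi1 (R : realType) (H : finType) (d : measure_display)
    (Om : measurableType d) (P : probability Om R)
    (x y : H -> R) (alpha beta : R) (arrives : shipment H -> set Om)
    (S : {set H}) : \bar R :=
  ('E_P [output x y alpha beta arrives S])%E.

(* Main.v *)
(* Conditioning on the shipments one after the other expresses the expected
   output as an iterated mean, which is supermodular in the amounts received so
   far because x^alpha * y^beta is.  Pooling the two shipments of h then changes
   the mean M of the remaining shipments by
   p_h (1 - p_h) (M(a, b) + M(a + x_h, b + y_h) - M(a + x_h, b) - M(a, b + y_h)),
   which is nonnegative. *)
Require Import Defs.
From mathcomp Require Import all_boot all_order all_algebra.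
From mathcomp Require Import all_classical all_reals all_analysis.
From mathcomp Require Import measurable_realfun ring lra.
Import Order.TTheory GRing.Theory Num.Theory.
Local Open Scope ring_scope.

(** * Expected output over independent arrivals as an iterated mean *)

Section IndependentArrivals.
Context {R : realType} {I : finType} (q u v : I -> R).

(** Expected value of [f] when [a] and [b] are already received and each [i] in [l] independently
    adds [(u i, v i)] with probability [q i]. The recursion conditions on the head of [l], so no
    probability space enters. *)
Fixpoint mean_output (f : R -> R -> R) (l : seq I) (a b : R) : R :=
  if l is i :: l' then
    q i * mean_output f l' (a + u i) (b + v i)
    + (1 - q i) * mean_output f l' a b
  else f a b.

Context {d : measure_display} {Om : measurableType d} (P : probability Om R).
Context (E : I -> set Om) (D : {set I}).
Hypothesis E_meas : forall i, measurable (E i).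
Hypothesis E_prob : forall i, P (E i) = (q i)%:E.
Hypothesis E_indep : mutually_independent P D E.

Lemma measurable_sum_arrived (c : I -> R) (a : R) (l : seq I) :
  measurable_fun setT (fun w => a + \sum_(i <- l | w \in E i) c i).
Proof.
apply: measurable_funD => //.
(* Indicators turn a sum whose range depends on [w] into a fixed finite sum of measurable
   functions. *)
have -> : (fun w => \sum_(i <- l | w \in E i) c i) =
          (fun w => \sum_(i <- l) c i * \1_(E i) w).
  apply/funext => w; rewrite big_mkcond; apply: eq_bigr => i _.
  by rewrite indicE; case: ifP => _; rewrite ?mulr1 ?mulr0.
by apply: measurable_sum => i; apply: measurable_funM.
Qed.

Lemma bigcap_setU1_finset (A : {set I}) (i : I) :
  (\bigcap_(j in [set` i |: A]%SET) E j = (\bigcap_(j in [set` A]) E j) `&` E i)%classic.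
Proof.
apply/seteqP; split=> w /=.
  move=> Ew; split; last by apply: Ew; rewrite /= setU11.
  by move=> j /= jA; apply: Ew; rewrite /= inE jA orbT.
by move=> [Ew Ei] j /=; rewrite !inE => /predU1P[->//|]; exact: Ew.
Qed.

Variable f : R -> R -> R.
Hypothesis f_ge0 : forall a b, 0 <= f a b.
Hypothesis f_meas : measurable_fun setT (fun z : R * R => f z.1 z.2).

Let total (l : seq I) (a b : R) (w : Om) : R :=
  f (a + \sum_(i <- l | w \in E i) u i) (b + \sum_(i <- l | w \in E i) v i).

Let measurable_total l a b : measurable_fun setT (EFin \o total l a b).
Proof.
apply/measurable_EFinP.
apply: (measurableT_comp f_meas
  (measurable_fun_pair (measurable_sum_arrived u a l) (measurable_sum_arrived v b l))).
Qed.

(* Splitting the region of integration along the first event of [l] turns the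
   claim into two instances for the tail, with [A] and [i |: A]: only
   intersections of the [E i] ever occur, never their complements. *)
Lemma integral_total (l : seq I) (A : {set I}) (a b : R) :
  uniq l -> A \subset D -> {subset l <= D} -> {in l, forall i, i \notin A} ->
  (\int[P]_(w in \bigcap_(i in [set` A]) E i) (total l a b w)%:E =
   ((\prod_(i in A) q i) * mean_output f l a b)%:E)%E.
Proof.
have capM (B : {set I}) : measurable (\bigcap_(i in [set` B]) E i)%classic.
  exact: fin_bigcap_measurable.
elim: l A a b => [|i l IH] A a b /=.
  move=> _ AD _ _.
  (* With no shipment left the integrand is constant, and independence gives the measure of the
     region as a product. *)
  rewrite (eq_integral (cst (f a b)%:E)); last first.
    by move=> w _; rewrite /total !big_nil !addr0.
  rewrite integral_cst// mulrC EFinM; congr (_ * _)%E.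
  apply: (etrans (E_indep _ AD)).
  by rewrite (eq_bigr (fun i => (q i)%:E))// prodEFin.
move=> /andP[il ul] AD lD lA.
have iA : i \notin A by apply: lA; rewrite mem_head.
have iD : i \in D by apply: lD; rewrite mem_head.
have lD' : {subset l <= D} by move=> j jl; apply: lD; rewrite inE jl orbT.
have lA' : {in l, forall j, j \notin A}.
  by move=> j jl; apply: lA; rewrite inE jl orbT.
have liA : {in l, forall j, j \notin (i |: A)%SET}.
  move=> j jl; rewrite !inE negb_or lA'// andbT.
  by apply: contraNneq il => <-.
have iAD : (i |: A)%SET \subset D by rewrite finset.subUset finset.sub1set iD.
set C := (\bigcap_(j in _) _)%classic.
have CM : measurable C by exact: capM.
have split_C (g : Om -> R) : (forall w, 0 <= g w) ->
    measurable_fun setT (EFin \o g) ->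
    (\int[P]_(w in C) (g w)%:E =
     \int[P]_(w in C `&` E i) (g w)%:E + \int[P]_(w in C `\` E i) (g w)%:E)%E.
  move=> g0 gm; rewrite -ge0_integral_setU//.
  - by rewrite setUIDK.
  - by apply: measurableI; [exact: CM|exact: E_meas].
  - by apply: measurableD; [exact: CM|exact: E_meas].
  - exact: measurable_funTS.
  - by move=> w _; rewrite lee_fin.
  - by apply/disj_setPS => w [[_ ?] [_ ?]].
have total_cons w : total (i :: l) a b w =
    if w \in E i then total l (a + u i) (b + v i) w else total l a b w.
  by rewrite /total !big_cons; case: ifP => // _; rewrite !addrA.
have total0 l' a' b' w : 0 <= total l' a' b' w by exact: f_ge0.
rewrite split_C//.
rewrite (eq_integral (fun w => (total l (a + u i) (b + v i) w)%:E)); last first.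
  by move=> w; rewrite inE => -[_ Eiw]; rewrite total_cons mem_set.
rewrite [X in (_ + X)%E](eq_integral (fun w => (total l a b w)%:E)); last first.
  by move=> w; rewrite inE => -[_ Eiw]; rewrite total_cons memNset.
have CiE : (C `&` E i = \bigcap_(j in [set` (i |: A)%SET]) E j)%classic.
  by rewrite bigcap_setU1_finset.
(* The integral [J] over the complement of [E i] in [C] is obtained by subtraction: the induction
   hypothesis gives the integrals of the same function over [C] and over its part inside [E i]. Both
   are finite, which rules out an infinite [J]. *)
have := IH A a b ul AD lD' lA'; rewrite -/C split_C// CiE !IH// big_setU1//=.
set J := integral _ _ _; case: J => [r| |] //= [eq_r].
congr EFin; rewrite mulrDr; lra.
Qed.

Lemma expectation_total (l : seq I) : uniq l -> {subset l <= D} ->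
  (\int[P]_w (f (\sum_(i <- l | w \in E i) u i) (\sum_(i <- l | w \in E i) v i))%:E
   = (mean_output f l 0 0)%:E)%E.
Proof.
move=> ul lD; have := @integral_total l finset.set0 0 0 ul (finset.sub0set _) lD.
rewrite big_set0 mul1r => <-; last by move=> i _; rewrite inE.
have -> : (\bigcap_(i in [set` finset.set0]) E i = setT :> set Om)%classic.
  by rewrite -subTset => w _ i /=; rewrite inE.
by apply: eq_integral => w _; rewrite /total !add0r.
Qed.

End IndependentArrivals.

(** * Supermodularity on the closed quadrant and its preservation by means *)

Section Supermodularity.
Context {R : realType}.

Definition supermodular (f : R -> R -> R) : Prop :=
  forall a a' b b', 0 <= a -> a <= a' -> 0 <= b -> b <= b' ->
    f a' b + f a b' <= f a b + f a' b'.

(** The defect of a product of two one-variable functions is the product of their increments, and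
    both powers are nondecreasing on the nonnegative reals. *)
Lemma supermodular_production (alpha beta : R) :
  0 <= alpha -> 0 <= beta -> supermodular (production alpha beta).
Proof.
move=> al be a a' b b' a0 aa' b0 bb'; rewrite /production.
have ha : a `^ alpha <= a' `^ alpha.
  by apply: ge0_ler_powR; rewrite ?nnegrE// (le_trans a0).
have hb : b `^ beta <= b' `^ beta.
  by apply: ge0_ler_powR; rewrite ?nnegrE// (le_trans b0).
rewrite -subr_ge0.
have -> : a `^ alpha * b `^ beta + a' `^ alpha * b' `^ beta -
    (a' `^ alpha * b `^ beta + a `^ alpha * b' `^ beta) =
    (a' `^ alpha - a `^ alpha) * (b' `^ beta - b `^ beta) by ring.
by rewrite mulr_ge0 ?subr_ge0.
Qed.

(** Translation by nonnegative loads stays in the quadrant, and convex combinations preserve the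
    inequality; induction on [l] combines the two. *)
Lemma supermodular_mean_output (I : finType) (q u v : I -> R)
    (f : R -> R -> R) (l : seq I) :
  (forall i, 0 <= q i <= 1) -> (forall i, 0 <= u i) -> (forall i, 0 <= v i) ->
  supermodular f -> supermodular (mean_output q u v f l).
Proof.
move=> q01 u0 v0 fs; elim: l => //= i l IH a a' b b' a0 aa' b0 bb'.
have /andP[q0 q1] := q01 i.
have h1 : mean_output q u v f l (a' + u i) (b + v i) +
    mean_output q u v f l (a + u i) (b' + v i) <=
    mean_output q u v f l (a + u i) (b + v i) +
    mean_output q u v f l (a' + u i) (b' + v i).
  by apply: IH; rewrite ?lerD2r ?addr_ge0.
have h0 := IH a a' b b' a0 aa' b0 bb'.
have := ler_wpM2l q0 h1.
have q'0 : 0 <= 1 - q i by rewrite subr_ge0.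
have := ler_wpM2l q'0 h0.
rewrite !mulrDr; lra.
Qed.

End Supermodularity.

(** * Comparison of two strategies, supplier by supplier *)

Section Strategies.
Context {R : realType} {H : finType} (x y p : H -> R).

(** A zero load for the missing input lets both totals run over the same list of shipments. *)
Definition x_load (s : shipment H) : R := if s.2 is OnlyY then 0 else x s.1.
Definition y_load (s : shipment H) : R := if s.2 is OnlyX then 0 else y s.1.

Definition supplier_shipments (S : {set H}) (h : H) : seq (shipment H) :=
  if h \in S then [:: (h, Pooled)] else [:: (h, OnlyX); (h, OnlyY)].

(** Shipments of one supplier are consecutive, so the lists for two strategies can be compared by
    induction on the suppliers. *)
Definition strategy_shipments (S : {set H}) (hs : seq H) : seq (shipment H) :=
  flatten [seq supplier_shipments S h | h <- hs].

Lemma mem_strategy_shipments (S : {set H}) (hs : seq H) (s : shipment H) :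
  s \in strategy_shipments S hs = (s.1 \in hs) && (s \in shipments S).
Proof.
elim: hs => //= h hs IH; rewrite /strategy_shipments /= mem_cat IH inE andb_orl.
congr (_ || _); rewrite /supplier_shipments {IH}.
case: s => h' k /=; case: ifPn => hS; rewrite !inE !xpair_eqE /=.
  by case: eqVneq => //= ->; case: k; rewrite hS.
by case: eqVneq => //= ->; case: k; rewrite ?hS ?(negbTE hS).
Qed.

Lemma uniq_strategy_shipments (S : {set H}) (hs : seq H) :
  uniq hs -> uniq (strategy_shipments S hs).
Proof.
elim: hs => //= h hs IH /andP[hhs uhs].
rewrite /strategy_shipments /= cat_uniq IH// andbT.
apply/andP; split; first by rewrite /supplier_shipments; case: ifP => //=; rewrite inE xpair_eqE eqxx.
apply/hasPn => s; rewrite -/(strategy_shipments S hs) mem_strategy_shipments.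
move=> /andP[shs _]; apply: contraNN hhs => sh.
suff <- : s.1 = h by [].
by move: sh; rewrite /supplier_shipments; case: ifP => _; rewrite !inE;
  [move=> /eqP ->|move=> /orP[]/eqP ->].
Qed.

Lemma big_x_load (Om : Type) (arrives : shipment H -> set Om) (S : {set H}) (w : Om) :
  \sum_(h in x_arrived arrives S w) x h =
  \sum_(s <- strategy_shipments S (index_enum H) | w \in arrives s) x_load s.
Proof.
rewrite big_flatten big_map [LHS]big_mkcond /=; apply: eq_bigr => h _.
rewrite !inE /x_shipment /supplier_shipments /x_load.
by case: (h \in S); rewrite !big_cons big_nil /=; do ?case: ifP; rewrite ?addr0.
Qed.

Lemma big_y_load (Om : Type) (arrives : shipment H -> set Om) (S : {set H}) (w : Om) :
  \sum_(h in y_arrived arrives S w) y h =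
  \sum_(s <- strategy_shipments S (index_enum H) | w \in arrives s) y_load s.
Proof.
rewrite big_flatten big_map [LHS]big_mkcond /=; apply: eq_bigr => h _.
rewrite !inE /y_shipment /supplier_shipments /y_load.
by case: (h \in S); rewrite !big_cons big_nil /=; do ?case: ifP; rewrite ?addr0 ?add0r.
Qed.

Hypothesis x_ge0 : forall h, 0 <= x h.
Hypothesis y_ge0 : forall h, 0 <= y h.
Hypothesis p01 : forall h, 0 <= p h <= 1.

Lemma x_load_ge0 s : 0 <= x_load s.
Proof. by rewrite /x_load; case: s => h [] /=. Qed.

Lemma y_load_ge0 s : 0 <= y_load s.
Proof. by rewrite /y_load; case: s => h [] /=. Qed.

Let mean (f : R -> R -> R) (S : {set H}) (hs : seq H) :=
  mean_output (fun s : shipment H => p s.1) x_load y_load f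
    (strategy_shipments S hs).

(** The two strategies treat the first supplier differently only if it lies in [S] but not in [T];
    otherwise the induction hypothesis, for all starting amounts, suffices. *)
Lemma mean_output_strategy_le (f : R -> R -> R) (S T : {set H}) (hs : seq H) (a b : R) :
  supermodular f -> T \subset S -> 0 <= a -> 0 <= b ->
  mean f T hs a b <= mean f S hs a b.
Proof.
move=> fs TS; elim: hs a b => [|h hs IH] a b a0 b0 //.
have sm : supermodular (mean f S hs).
  apply: supermodular_mean_output => // s; first exact: x_load_ge0.
  exact: y_load_ge0.
have /andP[q0 q1] := p01 h; have q'0 : 0 <= 1 - p h by rewrite subr_ge0.
have ax0 : 0 <= a + x h by rewrite addr_ge0.
have by0 : 0 <= b + y h by rewrite addr_ge0.
rewrite /mean /strategy_shipments /= /supplier_shipments.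
have [hT|hT] := boolP (h \in T).
  rewrite (fintype.subsetP TS _ hT) /= /x_load /y_load /=.
  by rewrite lerD// ler_wpM2l// IH.
have [hS|hS] := boolP (h \in S); rewrite /= /x_load /y_load /= !addr0;
  rewrite -!/(strategy_shipments _ _) -!/(mean _ _ _).
  set M := mean f S hs in sm IH *.
  (* The intermediate value lets [h] ship separately while all later suppliers already follow
     [S]. *)
  apply: (@le_trans _ _ (p h * (p h * M (a + x h) (b + y h) + (1 - p h) * M (a + x h) b)
    + (1 - p h) * (p h * M a (b + y h) + (1 - p h) * M a b))).
    by do !(rewrite lerD// || rewrite ler_wpM2l// || exact: IH).
  rewrite -subr_ge0.
  set d := (X in 0 <= X).
  (* Pooling raises the probabilities that both or neither of the inputs of [h] arrive by
     [p h * (1 - p h)] each, exactly what the two mixed outcomes lose. *)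
  have -> : d = p h * (1 - p h) * (M a b + M (a + x h) (b + y h)
                                 - (M (a + x h) b + M a (b + y h))).
    by rewrite /d; ring.
  by rewrite !mulr_ge0// subr_ge0 sm// lerDl.
by do !(rewrite lerD// || rewrite ler_wpM2l// || exact: IH).
Qed.

End Strategies.

Lemma measurable_production (R : realType) (alpha beta : R) :
  measurable_fun setT (fun z : R * R => production alpha beta z.1 z.2).
Proof.
apply: measurable_funM.
  exact: (measurableT_comp (measurable_powR alpha) measurable_fst).
exact: (measurableT_comp (measurable_powR beta) measurable_snd).
Qed.

Theorem proposition1 (R : realType) (H : finType) (x y p : H -> R)
    (alpha beta : R)
    (d : measure_display) (Om : measurableType d) (P : probability Om R)
    (arrives : shipment H -> set Om)
    (x_ge0 : forall h, 0 <= x h) (y_ge0 : forall h, 0 <= y h)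
    (p01 : forall h, 0 <= p h <= 1)
    (alpha_gt0 : 0 < alpha) (beta_gt0 : 0 < beta)
    (arrives_meas : forall s, measurable (arrives s))
    (arrives_prob : forall s, P (arrives s) = (p s.1)%:E)
    (arrives_indep : forall S : {set H},
       mutually_independent P (shipments S) arrives) :
  (forall S T : {set H}, T \subset S ->
     (Pi1 P x y alpha beta arrives T <= Pi1 P x y alpha beta arrives S)%E) /\
  (forall S : {set H},
     (Pi1 P x y alpha beta arrives S
        <= Pi1 P x y alpha beta arrives [set: H]%SET)%E).
Proof.
(* Each expected output is a finite iterated mean, so the comparison takes place in the reals. *)
have Pi1E S : Pi1 P x y alpha beta arrives S =
    (mean_output (fun s : shipment H => p s.1) (x_load x) (y_load y)
       (production alpha beta) (strategy_shipments S (index_enum H)) 0 0)%:E.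
  rewrite /Pi1 unlock -(expectation_total _ (x_load x) (y_load y) _ _ _ arrives_meas arrives_prob
    (arrives_indep S) _ _ (measurable_production _ alpha beta)).
  - by apply: eq_integral => w _; rewrite /output big_x_load big_y_load.
  - by move=> a b; rewrite /production mulr_ge0 ?powR_ge0.
  - exact: uniq_strategy_shipments (index_enum_uniq H).
  - by move=> s; rewrite mem_strategy_shipments => /andP[].
have mono (S T : {set H}) : T \subset S ->
    (Pi1 P x y alpha beta arrives T <= Pi1 P x y alpha beta arrives S)%E.
  move=> TS; rewrite !Pi1E lee_fin mean_output_strategy_le//.
  exact: supermodular_production (ltW alpha_gt0) (ltW beta_gt0).
by split=> // S; exact/mono/finset.subsetT.
Qed.
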